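(* Let $p$ be an odd prime. Let $B=(b_k)_{k\ge0}$ be a sequence of positive integers (not necessarily increasing) such that (i) for each $k$, $p^k$ is the largest power of $p$ dividing $b_k$, and (ii) $b_k=p^k$ for all sufficiently large $k$. Then $B$ is a valid basis, i.e. there exists a $p$-Stanley sequence $S_p(A)$ that is basic with basis $B$.
   Context: Let $p$ be an odd prime. A set of integers is $p$-free if it contains no $p$-term arithmetic progression with nonzero common difference. For a finite $p$-free set $A=\{a_0<\cdots<a_k\}$ of nonnegative integers, the $p$-Stanley sequence $S_p(A)=(a_n)_{n\ge0}$ is defined greedily: once $a_0<\cdots<a_n$ (with $n\ge k$) are defined, $a_{n+1}$ is the smallest integer greater than $a_n$ such that $\{a_0,\ldots,a_{n+1}\}$ is $p$-free. $S_p(A)$ is also regarded as a set. A $p$-Stanley sequence $S_p(A)$ is basic with basis $B=(b_k)_{k\ge0}$ if there is a constant $\alpha\in\mathbb{N}$ (positive integer) such that $b_k=\alpha\cdot p^k$ for all sufficiently large $k$, and $$S_p(A)=\Big\{\sum_k\delta_kb_k\ \Big|\ \delta_k\in\{0,1,\ldots,p-2\},\ \delta_k\ne0\text{ for only finitely many }k\Big\},$$ where these sums are all distinct. *)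

(* Defs.v *)
From mathcomp Require Import all_boot all_order all_algebra.
From mathcomp Require Import finmap.

Set Implicit Arguments.
Unset Strict Implicit.
Unset Printing Implicit Defensive.

Import GRing.Theory.

Local Open Scope nat_scope.

Definition p_free (p : nat) (S : {pred int}) : Prop :=
  ~ exists x d : int, d <> 0%R /\ (forall i, i < p -> (x + d *+ i)%R \in S).

Definition p_free_seq (p : nat) (s : seq nat) : Prop :=
  p_free p [pred x in [seq n%:Z%R | n <- s]].

(* A nonempty finite p-free set {a_0 < ... < a_k} of nonnegative integers is
   given by its strictly increasing enumeration, so that k = (size A).-1. *)
Definition initial_set (p : nat) (A : seq nat) : Prop :=
  [/\ 0 < size A, sorted ltn A & p_free_seq p A].

(* [a] is the sequence S_p(A).  Integers greater than [a n] are nonnegative, so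
   the candidates [m] for the next term can be taken in nat. *)
Definition stanley_sequence (p : nat) (A : seq nat) (a : nat -> nat) : Prop :=
  (forall i, i < size A -> a i = nth 0 A i) /\
  (forall n, (size A).-1 <= n ->
     [/\ a n < a n.+1,
         p_free_seq p (mkseq a n.+2)
       & forall m, a n < m -> p_free_seq p (rcons (mkseq a n.+1) m) ->
           a n.+1 <= m]).

Definition digits (p : nat) (delta : {fsfun nat -> nat with 0}) : Prop :=
  forall k, delta k <= p - 2.

Definition basis_sum (b : nat -> nat) (delta : {fsfun nat -> nat with 0}) : nat :=
  \sum_(k <- finsupp delta) delta k * b k.

Definition basic_with_basis (p : nat) (a b : nat -> nat) : Prop :=
  [/\ exists2 alpha, 0 < alpha &
        exists K, forall k, K <= k -> b k = alpha * p ^ k,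
      forall x, (exists n, a n = x) <->
        (exists2 delta, digits p delta & basis_sum b delta = x)
    & forall delta delta', digits p delta -> digits p delta' ->
        basis_sum b delta = basis_sum b delta' -> delta = delta'].

Definition valid_basis (p : nat) (b : nat -> nat) : Prop :=
  exists A a, [/\ initial_set p A, stanley_sequence p A a & basic_with_basis p a b].

(* Main.v *)
Require Import Defs.
From mathcomp Require Import all_boot all_order all_algebra.
From mathcomp Require Import finmap zify.

Set Implicit Arguments.
Unset Strict Implicit.
Unset Printing Implicit Defensive.

Local Open Scope nat_scope.

(** The theorem is true because the numbers [b k] behave like the place values
of a base-[p] numeral system.  Since the [p]-adic valuation of [b k] is [k], the
value of an expansion modulo [p ^ m] determines its digits below [m], as long as
all digits are less than [p] ([expansion_mod_inj]); counting then shows that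
every residue modulo [p ^ m] has an expansion ([expansion_mod]).

Let [S] be the set of sums all of whose digits are at most [p - 2].

- [S] contains no progression of length [p] ([basis_sums_free]).  If the
  common difference has valuation [v], the terms agree in all digits below [v],
  and their digits at [v] are pairwise distinct; but only [p - 1] digit values
  are available.

- Every large [x] outside [S] is the last term of a progression of length [p]
  whose other terms are in [S] ([ends_progression]).  As [b k = p ^ k] for
  [K <= k], such an [x] has a finite expansion with digits less than [p]
  ([expansion]), and some digit equals [p - 1].  Letting all the digits [p - 1]
  of [x] run simultaneously through [0, ..., p - 1] gives the progression.

These two facts say that, beyond some threshold, enumerating [S] is the same as
running the greedy algorithm, so a long enough initial segment of [S] generates
[S] ([stanley_sequence_of_set]). *)

(** * Greedy sequences *)

(** The difference of a progression of integers may be negative: the progression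
is then read backwards, from its last term. *)
Lemma p_free_seqP (p : nat) (s : seq nat) : 0 < p ->
  p_free_seq p s <->
  forall x d, 0 < d -> ~ (forall i, i < p -> x + i * d \in s).
Proof.
move=> p_gt0.
have memZ (n : nat) : ((n%:Z)%R \in [seq (k%:Z)%R | k <- s]) = (n \in s).
  by rewrite mem_map // => m k [].
split=> [free x d d_gt0 xdS | free [x [d [d_neq0 xdS]]]].
  apply: free; exists (x%:Z)%R, (d%:Z)%R; split; first by lia.
  move=> i /xdS; rewrite -memZ inE.
  by rewrite (_ : (x + i * d)%:Z%R = (x%:Z + d%:Z *+ i)%R) //; lia.
have term i : i < p -> exists2 n, n \in s & (n%:Z = x + d *+ i)%R.
  by move=> /xdS; rewrite inE => /mapP[n ns ->]; exists n.
have [n0 _ n0E] := term 0 p_gt0.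
have [n1 _ n1E] : exists2 n, n \in s & (n%:Z = x + d *+ p.-1)%R.
  by apply: term; rewrite prednK.
have [d_gt0 | d_lt0] : (0 < d \/ d < 0)%R by lia.
  apply: (free n0 `|d|%N); first by lia.
  move=> i /term[n ns nE]; rewrite (_ : n0 + _ = n) //.
  by move: nE n0E; rewrite GRing.mulr0n; nia.
apply: (free n1 `|d|%N); first by lia.
move=> i i_lt; have [|n ns nE] := term (p.-1 - i); first by lia.
rewrite (_ : n1 + _ = n) //.
have: (d *+ p.-1 = d *+ (p.-1 - i) + d *+ i)%R.
  by rewrite -GRing.mulrnDr; congr (_ *+ _)%R; lia.
by move: nE n1E; nia.
Qed.

Lemma increasing_enumeration (S : pred nat) :
  (forall n, exists2 m, n <= m & S m) ->
  exists a : nat -> nat,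
    [/\ forall n, a n < a n.+1,
        forall n m, a n < m -> S m -> a n.+1 <= m
      & forall x, (exists n, a n = x) <-> S x].
Proof.
move=> Sinf.
have exS n : exists m, (n <= m) && S m.
  by have [m nm Sm] := Sinf n; exists m; rewrite nm.
pose next n := ex_minn (exS n).
have next_ge n : n <= next n by rewrite /next; case: ex_minnP => m /andP[].
have nextS n : S (next n) by rewrite /next; case: ex_minnP => m /andP[].
have next_min n m : n <= m -> S m -> next n <= m.
  by rewrite /next; case: ex_minnP => k _ min nm Sm; apply: min; rewrite nm.
pose a := fix a n := if n is m.+1 then next (a m).+1 else next 0.
have a_lt n : a n < a n.+1 by apply: next_ge.
exists a; split=> // [n m lt Sm | x]; first exact: next_min.
split=> [[n <-] | Sx]; first by case: n => [|n]; apply: nextS.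
have a_ge n : n <= a n.
  by elim: n => // n IHn; apply: leq_ltn_trans IHn (a_lt n).
have [n] : exists n, x <= a n by exists x.
elim: n => [|n IHn] x_le; first by exists 0; apply/eqP; rewrite eqn_leq x_le next_min.
have [/IHn // | lt] := leqP x (a n).
by exists n.+1; apply/eqP; rewrite eqn_leq x_le next_min.
Qed.

(** The last hypothesis makes the greedy algorithm skip every number [>= C] that
is not in [S], and [p]-freeness makes it accept every element of [S]. *)
Lemma stanley_sequence_of_set (p C : nat) (S : pred nat) :
  0 < p ->
  (forall n, exists2 m, n <= m & S m) ->
  (forall x d, 0 < d -> ~ (forall i, i < p -> S (x + i * d))) ->
  (forall x, C <= x -> ~~ S x -> exists y d,
     [/\ 0 < d, x = y + p.-1 * d & forall i, i < p.-1 -> S (y + i * d)]) ->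
  exists A a, [/\ initial_set p A, stanley_sequence p A a
    & forall x, (exists n, a n = x) <-> S x].
Proof.
move=> p_gt0 Sinf Sfree Sgreedy.
have [a [a_lt a_gap aS]] := increasing_enumeration Sinf.
have a_mono : {homo a : m n / m < n} by apply: homo_ltn => // ? ? ?; apply: ltn_trans.
have a_ge n : n <= a n.
  by elim: n => // n IHn; apply: leq_ltn_trans IHn (a_lt n).
have a_free n : p_free_seq p (mkseq a n).
  apply/p_free_seqP => // x d d_gt0 xdS; apply: (Sfree x d d_gt0) => i /xdS.
  by case/mapP=> j _ ->; apply/aS; exists j.
(* [a n >= n], so from its last element on, this initial segment is past [C]. *)
exists (mkseq a C.+1), a; split=> //.
  split; rewrite ?size_mkseq //.
  by rewrite sorted_map; apply: sub_sorted (iota_ltn_sorted _ _) => m n /a_mono.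
split=> [i | n]; rewrite size_mkseq => n_C; first by rewrite nth_mkseq.
split=> // m an_m m_free; rewrite leqNgt; apply/negP => m_lt.
have C_m : C <= m by apply: leq_trans (ltnW an_m); apply: leq_trans n_C (a_ge n).
have mNS : ~~ S m by apply/negP => /(a_gap _ _ an_m); rewrite leqNgt m_lt.
have [y [d [d_gt0 mE ydS]]] := Sgreedy m C_m mNS.
move/p_free_seqP: m_free => /(_ p_gt0 y d d_gt0); apply=> i i_lt.
rewrite mem_rcons inE; have [-> | i_neq] := eqVneq i p.-1; first by rewrite mE eqxx.
have {i_neq}i_lt : i < p.-1 by lia.
have /aS[j jE] := ydS i i_lt; apply/orP; right; rewrite -jE.
apply: map_f; rewrite mem_iota /= add0n ltnNge; apply/negP => n_j.
have : a n.+1 <= a j by move: n_j; rewrite leq_eqVlt => /predU1P[-> // | /a_mono/ltnW].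
rewrite leqNgt jE => /negP; apply; apply: ltn_trans m_lt.
by rewrite mE ltn_add2l ltn_pmul2r.
Qed.

(** * Finitely supported digit sequences as functions *)

(** The index [n] is only a lower bound for the length of the sum, so that several
expansions can be compared at a common length. *)
Lemma basis_sum_ord (b : nat -> nat) (delta : {fsfun nat -> nat with 0}) :
  exists n, forall m, n <= m -> basis_sum b delta = \sum_(k < m) delta k * b k.
Proof.
exists (\max_(k <- finsupp delta) k).+1 => m le_m.
rewrite -(big_mkord xpredT (fun k => delta k * b k)) /basis_sum /index_iota subn0.
have sub : (finsupp delta `<=` seq_fset tt (iota 0 m))%fset.
  apply/fsubsetP=> k kd; rewrite seq_fsetE mem_iota /= add0n.
  by apply: leq_trans le_m; rewrite ltnS; apply: leq_bigmax_seq.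
rewrite (big_fset_incl _ sub) => [|k _ kd]; last by rewrite fsfun_dflt.
apply: perm_big; apply: uniq_perm; rewrite ?fset_uniq ?iota_uniq //.
by move=> k; rewrite seq_fsetE.
Qed.

Lemma basis_sum_of_fun (p m : nat) (b d : nat -> nat) :
  (forall k, k < m -> d k <= p - 2) ->
  exists2 delta, digits p delta & basis_sum b delta = \sum_(k < m) d k * b k.
Proof.
move=> d_le; pose D := seq_fset tt (iota 0 m).
pose delta := [fsfun k in D => d k] : {fsfun nat -> nat with 0}.
have deltaE k : delta k = if k < m then d k else 0.
  by rewrite fsfunE seq_fsetE mem_iota.
exists delta => [k | ]; first by rewrite deltaE; case: ifP => // /d_le.
have [n /(_ (maxn m n) (leq_maxr _ _)) ->] := basis_sum_ord b delta.
rewrite (big_ord_widen _ (fun k => d k * b k) (leq_maxl m n)) [RHS]big_mkcond /=.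
by apply: eq_bigr => k _; rewrite deltaE; case: ifP.
Qed.

(** * Expansions in a basis *)

(** Cancelling the valuation leaves [x] and [y] multiplied by a unit modulo [p]. *)
Lemma eq_of_mul_mod p n x y : prime p -> 0 < n -> x < p -> y < p ->
  x * n = y * n %[mod p ^ (logn p n).+1] -> x = y.
Proof.
move=> p_prime n_gt0; wlog le_xy : x y / x <= y.
  move=> W xp yp; have [le_xy | /ltnW le_yx] := leqP x y; first exact: W.
  by move=> /esym/W-/(_ le_yx yp xp).
have [c pc nE] := pfactor_coprime p_prime n_gt0.
move=> xp yp /esym/eqP; rewrite eqn_mod_dvd ?leq_mul2r ?le_xy ?orbT // -mulnBl.
rewrite {2}nE mulnA expnS dvdn_pmul2r ?expn_gt0 ?prime_gt0 // Gauss_dvdl //.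
by move=> /dvdn_leq; rewrite subn_gt0; lia.
Qed.

Section Expansions.

Variables (p : nat) (b : nat -> nat).
Hypothesis p_prime : prime p.
Hypothesis b_pos : forall k, 0 < b k.
Hypothesis b_ppart : forall k, (b k)`_p = p ^ k.

Lemma dvdn_basis m k : m <= k -> p ^ m %| b k.
Proof.
by move=> mk; apply: dvdn_trans (dvdn_exp2l p mk) _; rewrite -b_ppart dvdn_part.
Qed.

Lemma logn_basis k : logn p (b k) = k.
Proof. by apply: (expnI (prime_gt1 p_prime)); rewrite -p_part. Qed.

Lemma basis_gt k : k < b k.
Proof.
apply: leq_trans (ltn_expl k (prime_gt1 p_prime)) _.
by apply: dvdn_leq => //; apply: dvdn_basis.
Qed.

(** From [k = m] on, every [b k] is a multiple of [p ^ m]. *)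
Lemma basis_sum_mod m (delta : {fsfun nat -> nat with 0}) :
  basis_sum b delta = \sum_(k < m) delta k * b k %[mod p ^ m].
Proof.
have [n /(_ (m + n) (leq_addl _ _)) ->] := basis_sum_ord b delta.
rewrite big_split_ord /= -modnDmr.
rewrite (_ : (\sum_(i < n) _) %% _ = 0) ?addn0 //; apply/eqP.
by apply: dvdn_sum => i _; rewrite dvdn_mull // dvdn_basis // leq_addr.
Qed.

(** By induction the digits below the last position [m] agree already modulo
[p ^ m]; what is left of the congruence compares the digits at [m]. *)
Lemma expansion_mod_inj m (d d' : nat -> nat) :
  (forall k, k < m -> d k < p) -> (forall k, k < m -> d' k < p) ->
  \sum_(k < m) d k * b k = \sum_(k < m) d' k * b k %[mod p ^ m] ->
  forall k, k < m -> d k = d' k.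
Proof.
elim: m => // m IHm dp d'p eq_mod.
have agree k : k < m -> d k = d' k.
  apply: IHm => [j /ltnW/dp | j /ltnW/d'p |] //.
  have /(congr1 (modn^~ (p ^ m))) := eq_mod.
  rewrite !modn_dvdm ?dvdn_exp2l // !big_ord_recr /=.
  have drop t : t * b m = 0 %[mod p ^ m].
    by apply/eqP; rewrite mod0n; apply: dvdn_mull; apply: dvdn_basis.
  by rewrite -modnDmr -[RHS]modnDmr !(drop (_ m)) mod0n !addn0.
move=> k; rewrite ltnS leq_eqVlt => /predU1P[-> | /agree //].
apply: (@eq_of_mul_mod p (b m)); rewrite ?dp ?d'p // logn_basis.
move: eq_mod; rewrite !big_ord_recr /=.
under eq_bigr => j _ do rewrite agree //.
by move/eqP; rewrite eqn_modDl => /eqP.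
Qed.

Lemma basis_sum_inj (delta delta' : {fsfun nat -> nat with 0}) :
  digits p delta -> digits p delta' ->
  basis_sum b delta = basis_sum b delta' -> delta = delta'.
Proof.
have p_gt1 := prime_gt1 p_prime.
move=> dp d'p eq_sum; apply/fsfunP=> k; apply: (@expansion_mod_inj k.+1) => //.
- by move=> j _; have := dp j; lia.
- by move=> j _; have := d'p j; lia.
by rewrite -!basis_sum_mod eq_sum.
Qed.

(** Pigeonhole: [p] terms have only [p.-1] digits at position [v] to share, and
two terms with equal digits up to [v] are congruent modulo [p ^ v.+1], which
their difference, a multiple of [d] by less than [p], is not. *)
Lemma basis_sums_free x d : 0 < d ->
  ~ (forall i, i < p ->
       exists2 delta, digits p delta & basis_sum b delta = x + i * d).
Proof.
move=> d_gt0 xdS; have p_gt1 := prime_gt1 p_prime.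
have /fin_all_exists[delta deltaP] (i : 'I_p) : exists delta : {fsfun nat -> nat with 0},
    digits p delta /\ basis_sum b delta = x + i * d.
  by have [delta ? ?] := xdS i (ltn_ord i); exists delta.
pose v := logn p d.
have digit_lt (i : 'I_p) k : delta i k < p.-1.
  by have [/(_ k)] := deltaP i; lia.
have /injectivePn[i [j ij [eq_v]]] : ~~ injectiveb (fun i => Ordinal (digit_lt i v)).
  apply/negP => /injectiveP/leq_card; rewrite !card_ord; lia.
have [_ Ei] := deltaP i; have [_ Ej] := deltaP j.
have below k : k < v -> delta i k = delta j k.
  apply: expansion_mod_inj => [l _ | l _ |].
  - by have := digit_lt i l; lia.
  - by have := digit_lt j l; lia.
  have dv t : t * d = 0 %[mod p ^ v].
    by apply/eqP; rewrite mod0n; apply: dvdn_mull; apply: pfactor_dvdnn.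
  by rewrite -!basis_sum_mod Ei Ej -modnDmr dv -[RHS]modnDmr dv.
have : x + i * d == x + j * d %[mod p ^ v.+1].
  rewrite -Ei -Ej !(@basis_sum_mod v.+1); apply/eqP; congr (_ %% _).
  rewrite !big_ord_recr /= eq_v; congr (_ + _).
  by apply: eq_bigr => k _; rewrite below.
rewrite eqn_modDl => /eqP/(eq_of_mul_mod p_prime d_gt0 (ltn_ord i) (ltn_ord j)).
by move/val_inj/eqP; apply/negP.
Qed.

(** Distinct digit strings of length [m] have distinct values modulo [p ^ m], and
there are as many of them as residues. *)
Lemma expansion_mod m x :
  exists2 d : nat -> nat, (forall k, d k < p)
    & \sum_(k < m) d k * b k = x %[mod p ^ m].
Proof.
have p_gt0 := prime_gt0 p_prime; have pm_gt0 : 0 < p ^ m by rewrite expn_gt0 p_gt0.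
pose ext (f : {ffun 'I_m -> 'I_p}) k := if insub k is Some i then val (f i) else 0.
have ext_lt f k : ext f k < p by rewrite /ext; case: insub => //= i.
have extE f (i : 'I_m) : ext f i = f i by rewrite /ext valK.
pose value f := Ordinal (ltn_pmod (\sum_(k < m) ext f k * b k) pm_gt0).
have value_inj : injective value.
  move=> f g [eq_fg]; apply/ffunP => i; apply: val_inj; rewrite /= -!extE.
  exact: (expansion_mod_inj (fun k _ => ext_lt f k) (fun k _ => ext_lt g k) eq_fg).
have := inj_card_onto value_inj _ (Ordinal (ltn_pmod x pm_gt0)).
rewrite card_ffun !card_ord leqnn => /(_ isT)/codomP[f [Ef]].
by exists (ext f).
Qed.

(** An expansion modulo a power [p ^ m > x] is an expansion of [x] itself: the
digits below [K] contribute at most [x], the others less than [p ^ m], hence the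
value differs from [x] by less than [p ^ m]. *)
Lemma expansion K x :
  (forall k, K <= k -> b k = p ^ k) -> \sum_(k < K) p * b k <= x ->
  exists m (d : nat -> nat),
    (forall k, d k < p) /\ x = \sum_(k < m) d k * b k.
Proof.
move=> bK Cx; have p_gt1 := prime_gt1 p_prime.
set m := K + x; have [d dp dE] := expansion_mod m x.
exists m, d; split=> //.
have x_lt : x < p ^ m.
  by apply: leq_trans (ltn_expl m p_gt1); rewrite ltnS leq_addl.
have sum_lt : \sum_(k < m) d k * b k < x + p ^ m.
  have bound j : \sum_(k < K + j) d k * b k + p ^ K <= \sum_(k < K) p * b k + p ^ (K + j).
    elim: j => [|j IHj].
      rewrite addn0 leq_add2r; apply: leq_sum => k _.
      by rewrite leq_mul2r (ltnW (dp k)) orbT.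
    rewrite addnS big_ord_recr /= bK ?leq_addr // expnS.
    have : d (K + j) * p ^ (K + j) <= p.-1 * p ^ (K + j).
      by rewrite leq_mul2r; have := dp (K + j); lia.
    move: IHj; rewrite -(prednK (ltnW p_gt1)); move: (p.-1) => q /=; rewrite mulSn; lia.
  have := bound x; rewrite -/m.
  have : 0 < p ^ K by rewrite expn_gt0 ltnW.
  lia.
move: dE sum_lt; set s := \sum_(k < m) _ => /eqP.
have [sx | xs] := leqP s x.
  rewrite eq_sym eqn_mod_dvd // => dvd _.
  have diff_lt := leq_ltn_trans (leq_subr s x) x_lt.
  have : x - s = 0 by apply/eqP; rewrite -(modn_small diff_lt).
  lia.
rewrite eqn_mod_dvd ?(ltnW xs) // => /dvdn_leq; rewrite subn_gt0 => /(_ xs); lia.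
Qed.

(** The terms of the progression have the digits of [x], except that each digit
[p - 1] is replaced by [i]; then [d] is the sum of the [b k] at these places. *)
Lemma ends_progression K x :
  (forall k, K <= k -> b k = p ^ k) -> \sum_(k < K) p * b k <= x ->
  ~ (exists2 delta, digits p delta & basis_sum b delta = x) ->
  exists y d, [/\ 0 < d, x = y + p.-1 * d
    & forall i, i < p.-1 ->
        exists2 delta, digits p delta & basis_sum b delta = y + i * d].
Proof.
move=> bK Cx xNS; have p_gt1 := prime_gt1 p_prime.
have [m [c [cp xE]]] := expansion bK Cx.
pose top k := c k == p.-1.
pose y := \sum_(k < m) (if top k then 0 else c k) * b k.
pose d := \sum_(k < m) top k * b k.
have ydE i : y + i * d = \sum_(k < m) (if top k then i else c k) * b k.
  rewrite big_distrr -big_split /=; apply: eq_bigr => k _.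
  by case: ifP => _; rewrite ?mul0n ?mul1n ?muln0 ?addn0.
exists y, d; split.
- rewrite lt0n; apply/eqP => d0; apply: xNS; rewrite xE; apply: basis_sum_of_fun => k km.
  have : top k = false.
    apply/negbTE/negP => topk; move/eqP: d0.
    rewrite sum_nat_eq0 => /forallP/(_ (Ordinal km)); rewrite /= topk mul1n.
    by apply/negP; rewrite -lt0n.
  by have := cp k; rewrite /top; lia.
- by rewrite ydE xE; apply: eq_bigr => k _; case: ifP => // /eqP->.
move=> i ip; rewrite ydE.
apply: (@basis_sum_of_fun p m b (fun k => if top k then i else c k)) => k _.
by have := cp k; rewrite /top; case: eqP; lia.
Qed.

(** Boolean form of membership in the set of sums, which lets a minimum search
enumerate it; since [k < b k], no nonzero digit sits at a position above [x]. *)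
Definition is_basis_sum x :=
  [exists f : {ffun 'I_x.+1 -> 'I_p.-1}, \sum_k f k * b k == x].

Lemma is_basis_sumP x :
  reflect (exists2 delta, digits p delta & basis_sum b delta = x) (is_basis_sum x).
Proof.
have p_gt1 := prime_gt1 p_prime.
apply: (iffP existsP) => [[f /eqP <-] | [delta dp dE]].
  pose ext k := if insub k is Some i then val (f i) else 0.
  have extE (i : 'I_x.+1) : ext i = f i by rewrite /ext valK.
  under eq_bigr => k _ do rewrite -extE.
  apply: (@basis_sum_of_fun p x.+1 b ext) => k _; rewrite /ext; case: insub => //= i.
  by case: (f i) => j /=; lia.
have digit_lt k : delta k < p.-1 by have := dp k; lia.
exists [ffun k : 'I_x.+1 => Ordinal (digit_lt k)]; apply/eqP.
under eq_bigr => k _ do rewrite ffunE /=.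
have [n /(_ (x.+1 + n) (leq_addl _ _))] := basis_sum_ord b delta.
rewrite dE big_split_ord /= => xE; rewrite [RHS]xE [X in _ + X]big1 ?addn0 // => k _.
apply/eqP; rewrite muln_eq0; apply: contraT; rewrite negb_or -!lt0n => /andP[dk_gt0 _].
have : x < delta (x.+1 + k) * b (x.+1 + k).
  apply: leq_trans (leq_pmull _ dk_gt0).
  by apply: leq_trans (ltnW (basis_gt _)); apply: leq_addr.
move: xE; rewrite (bigD1 k) //=; lia.
Qed.

End Expansions.

(* [(b k)`_p] is the p-part of [b k], the largest power of p dividing it. *)
Theorem theorem6p9 (p : nat) (b : nat -> nat)
    (p_prime : prime p) (p_odd : odd p)
    (b_pos : forall k, 0 < b k)
    (b_ppart : forall k, (b k)`_p = p ^ k)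
    (b_eventually : exists K, forall k, K <= k -> b k = p ^ k) :
  valid_basis p b.
Proof.
have p_gt1 := prime_gt1 p_prime; have p_gt0 := ltnW p_gt1.
have [K bK] := b_eventually.
have SP := is_basis_sumP p_prime b_pos b_ppart.
pose S := is_basis_sum p b.
(* The [b n] are themselves sums, with a digit [1], allowed because [p] is odd. *)
have S_inf n : exists2 m, n <= m & S m.
  exists (b n); first by rewrite ltnW // (basis_gt p_prime).
  have [k _|delta dp dE] := @basis_sum_of_fun p n.+1 b (fun k => k == n).
    have : p != 2 by apply: contraTneq p_odd => ->.
    by case: eqP => //=; lia.
  apply/SP; exists delta => //; rewrite dE big_ord_recr /= eqxx mul1n big1 // => k _.
  by rewrite ltn_eqF.
have S_free x d : 0 < d -> ~ (forall i, i < p -> S (x + i * d)).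
  move=> d_gt0 xdS; apply: (basis_sums_free p_prime b_pos b_ppart d_gt0) => i ip.
  exact/SP/xdS.
have S_greedy x : \sum_(k < K) p * b k <= x -> ~~ S x -> exists y d,
    [/\ 0 < d, x = y + p.-1 * d & forall i, i < p.-1 -> S (y + i * d)].
  move=> Cx /SP xNS.
  have [y [d [d_gt0 xE ydS]]] :=
    ends_progression p_prime b_pos b_ppart bK Cx xNS.
  by exists y, d; split=> // i ip; apply/SP/ydS.
have [A [a [A_init a_stanley aS]]] :=
  stanley_sequence_of_set p_gt0 S_inf S_free S_greedy.
exists A, a; split=> //; split.
- by exists 1 => //; exists K => k /bK ->; rewrite mul1n.
- by move=> x; split=> [/aS/SP | /SP/aS].
exact: basis_sum_inj.
Qed.
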